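(* Let $(F_n)_{n\ge 0}$ be the Fibonacci sequence and $(L_n)_{n\ge 0}$ the Lucas sequence. Then: (a) There are no odd near-perfect Fibonacci numbers and no odd near-perfect Lucas numbers; that is, for every $n\ge 0$, neither $F_n$ nor $L_n$ is an odd near-perfect number. (b) There are no near-perfect Fibonacci numbers $F_n$ with $\omega(F_n)\le 3$. (c) The only near-perfect Lucas number $L_n$ with exactly two distinct prime factors (i.e. $\omega(L_n)=2$) is $L_6=18$.
   Context: For a positive integer $m$, $\sigma(m)$ denotes the sum of the positive divisors of $m$ and $\omega(m)$ denotes the number of distinct prime factors of $m$. A positive integer $m$ is called near-perfect (with redundant divisor $d$) if there is a proper divisor $d$ of $m$ (a positive divisor $d$ with $d<m$) such that $\sigma(m)=2m+d$. The Fibonacci sequence is given by $F_0=0$, $F_1=1$, $F_{n+2}=F_{n+1}+F_n$ for all $n\ge 0$, and the Lucas sequence by $L_0=2$, $L_1=1$, $L_{n+2}=L_{n+1}+L_n$ for all $n\ge 0$. Near-perfect numbers are positive by definition, so $F_0=0$ is not near-perfect. *)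

(* Defs.v *)
From mathcomp Require Import all_boot.

Set Implicit Arguments.
Unset Strict Implicit.
Unset Printing Implicit Defensive.

Fixpoint fib (n : nat) : nat :=
  match n with
  | 0 => 0
  | 1 => 1
  | (n'.+1 as m).+1 => fib m + fib n'
  end.

Fixpoint lucas (n : nat) : nat :=
  match n with
  | 0 => 2
  | 1 => 1
  | (n'.+1 as m).+1 => lucas m + lucas n'
  end.

Definition sigma (m : nat) : nat := \sum_(d <- divisors m) d.

Definition omega (m : nat) : nat := size (primes m).

(* Since 0 < m, any d dividing m is positive. *)
Definition near_perfect (m : nat) : Prop :=
  0 < m /\ exists d : nat, [/\ d %| m, d < m & sigma m = 2 * m + d].

(* Main.v *)
(** If m is odd and near-perfect then sigma m is odd, so m is a square; the odd square Fibonacci and Lucas numbers are found by Cohn's argument, reducing modulo some L_k = 3 mod 4, where -1 and -4 are not squares.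

For even m, write m = 2^a r with r odd. Congruences on n exclude all small prime factors of r, so sigma m < 2 m when m has few prime factors, except when a small prime p divides m; then the multiples of the rank of apparition of p bring in further prime factors, or n is one of 6, 12, 18. *)
Require Import Defs.
From mathcomp Require Import all_boot.
From mathcomp Require Import zify.

Set Implicit Arguments.
Unset Strict Implicit.
Unset Printing Implicit Defensive.

(** * The divisor sum: multiplicativity, upper bounds and parity *)

Lemma sigma_coprimeM (a b : nat) :
  0 < a -> 0 < b -> coprime a b -> sigma (a * b) = sigma a * sigma b.
Proof.
move=> a0 b0 cab.
(* A divisor of a b splits in only one way: its factor in a is its gcd with a. This makes the
   product map injective, and below the same gcd is the witness for surjectivity. *)
have gcdl x y : x %| a -> y %| b -> gcdn (x * y) a = x.
  move=> xa yb; rewrite gcdnC Gauss_gcdl; first by apply/gcdn_idPr.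
  exact: coprime_dvdr yb cab.
have perm : perm_eq (divisors (a * b)) [seq x * y | x <- divisors a, y <- divisors b].
  apply: uniq_perm; first exact: divisors_uniq.
    apply: allpairs_uniq; rewrite ?divisors_uniq //.
    move=> _ _ /allpairsP[[x y] /= [+ + ->]] /allpairsP[[x' y'] /= [+ + ->]] /=.
    rewrite -!dvdn_divisors // => xa yb xa' yb' e.
    have ex : x = x' by rewrite -(gcdl x y) // e gcdl.
    move: e; rewrite -ex => /eqP; rewrite eqn_pmul2l ?(dvdn_gt0 a0 xa) //.
    by move/eqP ->.
  move=> d; rewrite -dvdn_divisors ?muln_gt0 ?a0 //.
  apply/idP/allpairsP => [dab|[[x y] /= [+ + ->]]]; last first.
    by rewrite -!dvdn_divisors // => xa yb; apply: dvdn_mul.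
  have ga : gcdn d a > 0 by rewrite gcdn_gt0 a0 orbT.
  exists (gcdn d a, d %/ gcdn d a) => /=; rewrite -!dvdn_divisors //.
  rewrite dvdn_gcdr mulnC divnK ?dvdn_gcdl //; split=> //.
  have cd : coprime (d %/ gcdn d a) (a %/ gcdn d a).
    by rewrite /coprime -(eqn_pmul2r ga) muln_gcdl !divnK ?dvdn_gcdl ?dvdn_gcdr ?mul1n.
  rewrite -(Gauss_dvdr _ cd) -(dvdn_pmul2r ga) divnK ?dvdn_gcdl //.
  by rewrite mulnAC divnK // dvdn_gcdr.
rewrite /sigma (perm_big _ perm) /= big_allpairs_dep /= big_distrl /=.
by apply: eq_bigr => x _; rewrite big_distrr.
Qed.

Lemma sigma_pfactor (p k : nat) :
  prime p -> sigma (p ^ k) = \sum_(i < k.+1) p ^ i.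
Proof.
move=> pp; have p1 := prime_gt1 pp.
have perm : perm_eq (divisors (p ^ k)) [seq p ^ i | i <- iota 0 k.+1].
  apply: uniq_perm; first exact: divisors_uniq.
    by rewrite map_inj_uniq ?iota_uniq //; apply: expnI.
  move=> d; rewrite -dvdn_divisors ?expn_gt0 ?prime_gt0 //.
  apply/(dvdn_pfactor _ _ pp)/mapP => -[i ik ->]; exists i => //.
    by rewrite mem_iota.
  by move: ik; rewrite mem_iota.
by rewrite /sigma (perm_big _ perm) big_map -(big_mkord xpredT (expn p)) /index_iota subn0.
Qed.

(** The bound sigma(p^k) / p^k < p / (p - 1), cleared of denominators; it comes from the geometric
    sum (p^(k+1) - 1) / (p - 1). *)
Lemma sigma_pfactor_leq (p k : nat) :
  prime p -> sigma (p ^ k) * p.-1 <= p ^ k * p.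
Proof.
move=> pp; rewrite sigma_pfactor // mulnC -predn_exp -expnSr; exact: leq_pred.
Qed.

Lemma omega_coprime_pfactor (p k r : nat) :
  prime p -> 0 < k -> 0 < r -> coprime p r -> omega r < omega (r * p ^ k).
Proof.
move=> pp k0 r0 cpr; have pk0 : 0 < p ^ k by rewrite expn_gt0 prime_gt0.
suff: size (p :: primes r) <= omega (r * p ^ k) by [].
apply: uniq_leq_size => [|q].
  by rewrite /= primes_uniq mem_primes pp r0 -prime_coprime // cpr.
rewrite inE primesM // => /orP[/eqP->|->//].
by rewrite orbC primesX // primes_prime ?inE ?eqxx.
Qed.

Lemma omega_eq0 (r : nat) : 0 < r -> omega r = 0 -> r = 1.
Proof.
move=> r0 /eqP; rewrite size_eq0 => /eqP pr; apply/eqP; rewrite eqn_leq r0 andbT leqNgt.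
apply/negP => r1; have : pdiv r \in primes r.
  by rewrite mem_primes pdiv_prime // r0 pdiv_dvd.
by rewrite pr.
Qed.

(* The k-th smallest prime factor of r is at least a + k - 1, so sigma r / r is bounded by a telescoping product of the x / (x - 1) with a <= x < a + k. *)
Lemma sigma_leq_omega (a k r : nat) :
  0 < r -> 1 < a -> omega r <= k -> (forall p, prime p -> p %| r -> a <= p) ->
  sigma r * a.-1 <= r * (a.-1 + k).
Proof.
elim: k a r => [|k IH] a r r0 a1 wr ge_a.
  have -> : r = 1 by apply: omega_eq0; rewrite //; lia.
  by rewrite /sigma (_ : divisors 1 = [:: 1]) // big_seq1; lia.
have [->|r1] := eqVneq r 1.
  by rewrite /sigma (_ : divisors 1 = [:: 1]) // big_seq1; lia.
have {}r1 : 1 < r by lia.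
set p := pdiv r; have pp : prime p := pdiv_prime r1.
have ap : a <= p by apply: ge_a => //; apply: pdiv_dvd.
have [r' cpr' er] := pfactor_coprime pp r0.
set e := logn p r in er.
have e0 : 0 < e by rewrite logn_gt0 mem_primes pp r0 pdiv_dvd.
have r'0 : 0 < r' by move: r0; rewrite er muln_gt0 => /andP[].
have pe0 : 0 < p ^ e by rewrite expn_gt0 prime_gt0.
have wr' : omega r' <= k.
  by have := omega_coprime_pfactor pp e0 r'0 cpr'; rewrite -er; lia.
(* Since p is the least prime factor of r and p >= a, the cofactor r' meets the induction hypothesis
   at a + 1. *)
have ge_p q : prime q -> q %| r' -> a.+1 <= q.
  move=> qp qr'; apply: leq_ltn_trans ap _.
  rewrite ltn_neqAle; apply/andP; split.
    by apply/eqP => pq; move: cpr'; rewrite prime_coprime // pq qr'.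
  by apply: pdiv_min_dvd; rewrite ?prime_gt1 // er dvdn_mulr.
have := IH a.+1 r' r'0 (leqW a1) wr' ge_p; have := sigma_pfactor_leq e pp.
rewrite {2}er {1}er sigma_coprimeM ?coprimeXr // 1?coprime_sym ?coprimeXl //.
move: (sigma (p ^ e)) (sigma r') => s t /= hs ht.
(* As x / (x - 1) decreases in x, p may be replaced by a <= p. *)
have {}hs : s * a.-1 <= p ^ e * a.
  rewrite -(@leq_pmul2r p.-1) //; last by have := prime_gt1 pp; lia.
  apply: (@leq_trans (p ^ e * p * a.-1)); first by rewrite mulnAC leq_mul2r hs orbT.
  by rewrite -!mulnA leq_mul2l; apply/orP; right; nia.
rewrite -(@leq_pmul2r a); last by lia.
have -> : t * s * a.-1 * a = (s * a.-1) * (t * a) by nia.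
have -> : r' * p ^ e * (a.-1 + k.+1) * a = (p ^ e * a) * (r' * (a + k)).
  by rewrite (_ : a.-1 + k.+1 = a + k); [nia | lia].
exact: leq_mul.
Qed.

(** By multiplicativity every sigma(p^e) with p^e exactly dividing m is odd. It is a sum of e + 1
    odd terms, so every exponent e is even. *)
Lemma odd_sigma_odd_sqr (m : nat) :
  odd m -> odd (sigma m) -> exists x, m = x ^ 2.
Proof.
elim/ltn_ind: m => m IH om os.
have m0 : 0 < m by case: m om {IH os}.
have [->|m1] := eqVneq m 1; first by exists 1.
have {}m1 : 1 < m by lia.
set p := pdiv m; have pp : prime p := pdiv_prime m1.
have [r cpr er] := pfactor_coprime pp m0.
set e := logn p m in er.
have e0 : 0 < e by rewrite logn_gt0 mem_primes pp m0 pdiv_dvd.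
have pe1 : 1 < p ^ e by rewrite -(exp1n e) ltn_exp2r // prime_gt1.
have r0 : 0 < r by move: m0; rewrite er muln_gt0 => /andP[].
move: om os; rewrite er sigma_coprimeM ?(ltnW pe1) //; last first.
  by rewrite coprime_sym coprimeXl.
rewrite !oddM oddX => /andP[odr]; rewrite gtn_eqF //= => op /andP[osr].
have [x ->] : exists x, r = x ^ 2 by apply: IH => //; nia.
rewrite sigma_pfactor // => ose; exists (x * p ^ e./2).
have -> : p ^ e = (p ^ e./2) ^ 2.
  rewrite -expnM -[in LHS](odd_double_half e) -muln2.
  suff -> : odd e = false by [].
  suff: odd (\sum_(i < e.+1) p ^ i) = odd e.+1 by rewrite ose /=; case: odd.
  elim: e.+1 => [|k IHk]; first by rewrite big_ord0.
  by rewrite big_ord_recr /= oddD IHk oddX op orbT addbT.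
by rewrite expnMn.
Qed.

(** * Sequences with the Fibonacci recurrence modulo q *)

Definition fib_rec (G : nat -> nat) : Prop := forall n, G n.+2 = G n.+1 + G n.

Lemma fib_recP : fib_rec fib. Proof. by []. Qed.

Lemma lucas_recP : fib_rec lucas. Proof. by []. Qed.

Definition rec_step (q : nat) (x : nat * nat) : nat * nat := (x.2, (x.1 + x.2) %% q).

Definition rec_init (G : nat -> nat) (q : nat) : nat * nat := (G 0 %% q, G 1 %% q).

(** A certificate checked by computation: the pair of consecutive residues modulo q returns to its
    start after P steps, and over one period [A] of the residue agrees with [B] of the index. *)
Definition period_check (G : nat -> nat) (q P : nat) (A B : pred nat) : bool :=
  (iter P (rec_step q) (rec_init G q) == rec_init G q) &&
  all2 (fun x i => A x.1 == B i) (traject (rec_step q) (rec_init G q) P) (iota 0 P).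

Lemma rec_iterE (G : nat -> nat) (q n : nat) :
  fib_rec G -> iter n (rec_step q) (rec_init G q) = (G n %% q, G n.+1 %% q).
Proof.
by move=> HG; elim: n => // n /= ->; rewrite /rec_step /= HG modnDm addnC.
Qed.

Lemma period_checkP (G : nat -> nat) (q P n : nat) (A B : pred nat) :
  fib_rec G -> 0 < P -> period_check G q P A B -> A (G n %% q) = B (n %% P).
Proof.
move=> HG P0 /andP[/eqP per]; rewrite all2E => /andP[_ /allP chk].
have nP : n %% P < P by rewrite ltn_pmod.
have /eqP <- : A (iter (n %% P) (rec_step q) (rec_init G q)).1 == B (n %% P).
  apply: (chk (iter (n %% P) (rec_step q) (rec_init G q), n %% P)).
  rewrite -(nth_traject _ nP (rec_init G q)) -[X in (_, X)](nth_iota 0 0 nP) -nth_zip.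
    by rewrite mem_nth // size_zip size_traject size_iota minnn.
  by rewrite size_traject size_iota.
suff -> : iter (n %% P) (rec_step q) (rec_init G q) = iter n (rec_step q) (rec_init G q).
  by rewrite rec_iterE.
rewrite {2}(divn_eq n P) addnC iterD; congr iter.
by elim: (n %/ P) => // i IH; rewrite mulSn iterD -IH per.
Qed.

(* The Pisano period divides four times the rank of apparition z of q. *)
Lemma fib_rank (q z n : nat) :
  0 < z -> period_check fib q (4 * z) (pred1 0) (fun i => z %| i) ->
  (q %| fib n) = (z %| n).
Proof.
move=> z0 chk; have := @period_checkP _ _ _ n _ _ fib_recP _ chk.
by rewrite muln_gt0 /= => /(_ z0); rewrite /dvdn /= modn_dvdm ?dvdn_mull.
Qed.

Lemma lucas_mod4_eq3 (n : nat) : (lucas n %% 4 == 3) = (n %% 6 \in [:: 2; 4; 5]).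
Proof.
exact: (@period_checkP _ 4 6 n (pred1 3) (fun i => i \in [:: 2; 4; 5]) lucas_recP).
Qed.

Lemma lucas_mod4_lt2 (n : nat) : (lucas n %% 4 < 2) = (n %% 6 \in [:: 1; 3]).
Proof.
exact: (@period_checkP _ 4 6 n (fun i => i < 2) (fun i => i \in [:: 1; 3]) lucas_recP).
Qed.

(** * Identities and divisibility for Fibonacci and Lucas numbers *)

Lemma fib_gt0 (n : nat) : 0 < n -> 0 < fib n.
Proof.
case: n => // n _; suff: (0 < fib n.+1) && (0 < fib n.+2) by case/andP.
by elim: n => // n /andP[h1 h2]; rewrite h2 fib_recP addn_gt0 h2.
Qed.

Lemma fib_gt1 (n : nat) : 2 < n -> 1 < fib n.
Proof.
by case: n => [|[|[|n]]] // _; rewrite fib_recP (@leq_add 1 1) // fib_gt0.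
Qed.

Lemma fib_addS (m n : nat) : fib (m + n.+1) = fib m * fib n + fib m.+1 * fib n.+1.
Proof.
elim: n m => [|n IH] m; first by rewrite addn1 muln0 muln1.
by rewrite -addSnnS IH !fib_recP; nia.
Qed.

Lemma coprime_fibS (n : nat) : coprime (fib n) (fib n.+1).
Proof.
by elim: n => // n IH; rewrite fib_recP /coprime gcdnDl gcdnC.
Qed.

(** Euclid's algorithm by subtraction, run on the indices: modulo F_a, F_(a+b) is F_(a+1) F_b, and
    F_(a+1) is coprime to F_a. *)
Lemma gcdn_fib (m n : nat) : gcdn (fib m) (fib n) = fib (gcdn m n).
Proof.
have step a b : gcdn (fib a) (fib (a + b)) = gcdn (fib a) (fib b).
  case: b => [|b]; first by rewrite addn0 gcdnn gcdn0.
  by rewrite fib_addS mulnC gcdnMDl Gauss_gcdr // coprime_fibS.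
have [s] := ubnP (m + n); elim: s m n => // s IH m n.
wlog mn : m n / m <= n => [H|].
  by case: (leqP m n) => h; [exact: H | rewrite gcdnC (gcdnC m) addnC; apply: H; lia].
case: m mn => [|m] mn; first by rewrite !gcd0n.
move=> hs; rewrite -(subnKC mn) step gcdnDl; apply: IH; lia.
Qed.

Lemma dvdn_fib (m n : nat) : m %| n -> fib m %| fib n.
Proof.
by move=> /gcdn_idPl mn; apply/gcdn_idPl; rewrite gcdn_fib mn.
Qed.

Lemma lucas_fib (n : nat) : lucas n.+1 = fib n + fib n.+2.
Proof.
suff: (lucas n.+1 == fib n + fib n.+2) && (lucas n.+2 == fib n.+1 + fib n.+3).
  by case/andP => /eqP.
elim: n => // n /andP[/eqP h1 /eqP h2]; rewrite h2 eqxx (lucas_recP n.+1) h2 h1 andTb.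
by apply/eqP; rewrite (fib_recP n.+2) (fib_recP n); lia.
Qed.

Lemma fib_double (n : nat) : fib (2 * n) = fib n * lucas n.
Proof.
case: n => // n; rewrite mul2n -addnn fib_addS lucas_fib fib_recP; nia.
Qed.

(** Here L_n = F_n + 2 F_(n-1), and an odd F_n is coprime to both 2 and F_(n-1). *)
Lemma coprime_fib_lucas (n : nat) : odd (fib n) -> coprime (fib n) (lucas n).
Proof.
case: n => // n od; rewrite lucas_fib fib_recP addnCA.
rewrite /coprime gcdnDl addnn -muln2 Gauss_gcdl; last by rewrite coprimen2.
by rewrite gcdnC -/(coprime _ _) coprime_fibS.
Qed.

(* L_k G_{m+k} = G_{m+2k} + (-1)^k G_m, with each sign moved to the side where it is positive. *)
Lemma fib_rec_lucas (G : nat -> nat) (k m : nat) : fib_rec G ->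
  G (m + 2 * k) + ~~ odd k * G m = lucas k * G (m + k) + odd k * G m.
Proof.
move=> HG.
(* The recurrence of L_k has order two, so the induction carries the cases k and k + 1 together, for
   all m. *)
suff: forall m, G (m + 2 * k) + ~~ odd k * G m = lucas k * G (m + k) + odd k * G m /\
  G (m + 2 * k.+1) + ~~ odd k.+1 * G m = lucas k.+1 * G (m + k.+1) + odd k.+1 * G m.
  by move=> /(_ m)[].
elim: k => [|k IH] {}m.
  by rewrite muln0 muln1 !addn0 addn2 addn1 HG /=; lia.
split; first exact: (IH m).2.
have [_] := IH m.+1; have [+ _] := IH m.+2.
rewrite lucas_recP /= !negbK.
have -> : m + 2 * k.+2 = (m + 2 * k).+4 by lia.
have -> : m.+1 + 2 * k.+1 = (m + 2 * k).+3 by lia.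
have -> : m.+2 + 2 * k = (m + 2 * k).+2 by lia.
have -> : m.+2 + k = (m + k).+2 by lia.
have -> : m.+1 + k.+1 = (m + k).+2 by lia.
have -> : m + k.+2 = (m + k).+2 by lia.
rewrite (HG (m + 2 * k).+2) (HG m); case: (odd k) => /=; nia.
Qed.

(** For even k, shifting the index by 2 k changes the sign of G modulo L_k, and t is an odd number
    of such shifts. The induction on t adds two shifts at a time. *)
Lemma lucas_dvdn_shift (G : nat -> nat) (k t m : nat) :
  fib_rec G -> ~~ odd k -> odd t -> lucas k %| G (m + 2 * k * t) + G m.
Proof.
move=> HG ek; have step i : lucas k %| G (i + 2 * k) + G i.
  have := @fib_rec_lucas G k i HG; rewrite (negbTE ek) mul1n mul0n addn0 => ->.
  exact: dvdn_mulr.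
move=> ot; rewrite -[t]odd_double_half ot; elim: t./2 => [|s IH]; first by rewrite muln1.
move: IH; set u := m + _ * (1 + s.*2) => IH.
have -> : m + 2 * k * (1 + s.+1.*2) = u + 2 * k + 2 * k.
  by rewrite /u doubleS; nia.
rewrite -(dvdn_addl _ (step u)).
have -> : G (u + 2 * k + 2 * k) + G m + (G (u + 2 * k) + G u) =
  (G (u + 2 * k + 2 * k) + G (u + 2 * k)) + (G u + G m) by lia.
by rewrite dvdn_addr ?step.
Qed.

(** * Sums of two squares, and squares among Fibonacci and Lucas numbers *)

Lemma dvdn_add_odd_exp (a b t : nat) : odd t -> a + b %| a ^ t + b ^ t.
Proof.
move=> ot; rewrite -[t]odd_double_half ot; elim: t./2 => [|s IH] //.
move: IH; rewrite !doubleS; set u := 1 + s.*2 => IH.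
have -> : 1 + s.*2.+2 = u.+2 by [].
(* Adding a multiple of the previous sum yields a product with factor a + b and avoids
   subtraction. *)
have <- := @dvdn_addl (a * b * (a ^ u + b ^ u)) (a + b) (a ^ u.+2 + b ^ u.+2) (dvdn_mull _ IH).
have -> : a ^ u.+2 + b ^ u.+2 + a * b * (a ^ u + b ^ u) = (a + b) * (a ^ u.+1 + b ^ u.+1).
  by rewrite !expnS; move: (a ^ u) (b ^ u) => A B; nia.
exact: dvdn_mulr.
Qed.

(** As (p - 1) / 2 is odd, x^2 + y^2 divides x^(p-1) + y^(p-1), which is 2 modulo p by Fermat's
    little theorem. *)
Lemma prime_dvdn_sqr_add_sqr (p x y : nat) :
  prime p -> p %% 4 = 3 -> coprime p y -> ~~ (p %| x ^ 2 + y ^ 2).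
Proof.
move=> pp p3 cpy; apply/negP => dv.
have cpx : coprime p x.
  rewrite prime_coprime //; apply/negP => px; move: dv.
  rewrite dvdn_addr; last by rewrite dvdn_exp.
  by rewrite Euclid_dvdX // andbT => py; move: cpy; rewrite prime_coprime // py.
have fermat z : coprime p z -> (z ^ 2) ^ (p.-1)./2 = 1 %[mod p].
  move=> cz; have ep : 2 * (p.-1)./2 = p.-1 by lia.
  have z0 : 0 < z.
    by case: z cz => //; rewrite /coprime gcdn0 => /eqP p1; rewrite p1 in pp.
  apply/eqP; rewrite -expnM ep eqn_mod_dvd ?expn_gt0 ?z0 //.
  rewrite -(Gauss_dvdr _ cz) mulnBr muln1 -expnS prednK ?prime_gt0 // -eqn_mod_dvd.
    exact/eqP/fermat_little.
  by rewrite -{1}(expn1 z) leq_pexp2l // prime_gt0.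
have ot : odd (p.-1)./2 by lia.
have := dvdn_trans dv (dvdn_add_odd_exp (x ^ 2) (y ^ 2) ot).
by rewrite /dvdn -modnDm !fermat // modnDm modn_small //; lia.
Qed.

(** If the least prime factor is not 3 modulo 4, it is 1 modulo 4, because q is odd; the cofactor is
    then a smaller number that is 3 modulo 4. *)
Lemma prime_dvdn_mod4_eq3 (q : nat) :
  q %% 4 = 3 -> exists p, [/\ prime p, p %| q & p %% 4 = 3].
Proof.
elim/ltn_ind: q => q IH q3.
have q1 : 1 < q by lia.
have pp := pdiv_prime q1; have [k eq] := dvdnP (pdiv_dvd q).
have [p3|p3] := eqVneq (pdiv q %% 4) 3; first by exists (pdiv q); rewrite pdiv_dvd.
have k3 : k %% 4 = 3.
  have := prime_gt1 pp; move: q3 p3; rewrite {1}eq -modnMm.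
  have := ltn_pmod k (isT : 0 < 4); have := ltn_pmod (pdiv q) (isT : 0 < 4).
  by move: (k %% 4) (pdiv q %% 4) => [|[|[|[|?]]]] [|[|[|[|?]]]].
have kq : k < q by rewrite [ltnRHS]eq; have := prime_gt1 pp; nia.
by have [r [rp rk r3]] := IH k kq k3; exists r; rewrite eq dvdn_mulr.
Qed.

Lemma dvdn_sqr_add_sqr (q x y : nat) :
  q %% 4 = 3 -> coprime q y -> ~~ (q %| x ^ 2 + y ^ 2).
Proof.
move=> q3 cqy; have [p [pp pq p3]] := prime_dvdn_mod4_eq3 q3.
apply: contra (prime_dvdn_sqr_add_sqr x pp p3 (coprime_dvdl pq cqy)).
exact: dvdn_trans pq.
Qed.

(* Cohn: m + n = m + 2 k t with k a power of 2, so that G_{m+n} = - G_m modulo L_k = 3 mod 4. *)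
Lemma fib_rec_nsqr (G : nat -> nat) (m n x y : nat) :
  fib_rec G -> 0 < n -> 4 %| n -> y %| 2 -> G m = y ^ 2 -> G (m + n) != x ^ 2.
Proof.
move=> HG n0 n4 y2 Gm; apply/eqP => Gx.
have [t ct en] := pfactor_coprime (isT : prime 2) n0.
have v2 : 1 < logn 2 n by rewrite -pfactor_dvdn.
(* Since 4 divides n, k is an even power of two's value prime to 3, hence 2 or 4 modulo 6, and L_k
   is 3 modulo 4. *)
set k := 2 ^ (logn 2 n).-1.
have {}en : n = 2 * k * t by rewrite en -(ltn_predK v2) expnS mulnC.
have ek : ~~ odd k by rewrite oddX; move: v2; case: (logn 2 n) => [|[]].
have k3 : k %% 3 != 0 by rewrite -/(dvdn 3 k) Euclid_dvdX.
have L3 : lucas k %% 4 = 3.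
  apply/eqP; rewrite lucas_mod4_eq3 !inE; lia.
have := @lucas_dvdn_shift G k t m HG ek; rewrite -coprime2n => /(_ ct).
rewrite -en Gx Gm; apply/negP; apply: dvdn_sqr_add_sqr => //.
by apply: coprime_dvdr y2 _; rewrite coprimen2; lia.
Qed.

(** A square is 0 or 1 modulo 4, which forces n to be odd. Then n differs by a multiple of 4 from 1
    or 3, where L_1 = 1 and L_3 = 4 are the base squares; L_3 itself is even. *)
Lemma odd_lucas_sqr (n x : nat) : odd (lucas n) -> lucas n = x ^ 2 -> n = 1.
Proof.
move=> ol ex.
have : n %% 6 \in [:: 1; 3].
  rewrite -lucas_mod4_lt2 ex expnS expn1 -modnMm.
  by have := ltn_pmod x (isT : 0 < 4); case: (x %% 4) => [|[|[|[|]]]].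
rewrite !inE => n6; have [n1|n3] : n %% 4 = 1 \/ n %% 4 = 3 by lia.
  have [//|nn1] := eqVneq n 1.
  have := @fib_rec_nsqr lucas 1 n.-1 x 1 lucas_recP.
  rewrite (_ : 1 + n.-1 = n) ?ex ?eqxx; last by lia.
  by case/(_ _ _ _ _)/negP => //; lia.
have [e3|nn3] := eqVneq n 3; first by rewrite e3 in ol.
have := @fib_rec_nsqr lucas 3 (n - 3) x 2 lucas_recP.
rewrite (_ : 3 + (n - 3) = n) ?ex ?eqxx; last by lia.
by case/(_ _ _ _ _)/negP => //; lia.
Qed.

(** The base square is F_1 = 1 when n is 1 modulo 4, and F_(-1) = 1 when n is 3 modulo 4. *)
Lemma odd_index_fib_sqr (n x : nat) : odd n -> fib n = x ^ 2 -> n = 1.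
Proof.
move=> on ex; have [n1|n3] : n %% 4 = 1 \/ n %% 4 = 3 by lia.
  have [//|nn1] := eqVneq n 1.
  have := @fib_rec_nsqr fib 1 n.-1 x 1 fib_recP.
  rewrite (_ : 1 + n.-1 = n) ?ex ?eqxx; last by lia.
  by case/(_ _ _ _ _)/negP => //; lia.
(* Here F is extended to the index -1 by F_{-1} = 1. *)
pose G i := if i is i'.+1 then fib i' else 1.
have HG : fib_rec G by case.
have := @fib_rec_nsqr G 0 n.+1 x 1 HG.
rewrite add0n /= ex eqxx => /(_ isT).
by case/(_ _ _ _)/negP => //; lia.
Qed.

(** * Odd near-perfect numbers *)

Lemma near_perfect_odd_sigma (m : nat) : odd m -> near_perfect m -> odd (sigma m).
Proof.
by move=> om [_ [d [dm _ ->]]]; rewrite oddD mul2n odd_double /= (dvdn_odd dm).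
Qed.

Lemma near_perfect_abundant (m : nat) : near_perfect m -> 2 * m < sigma m.
Proof.
move=> [m0 [d [dm _ ->]]]; have := dvdn_gt0 m0 dm; lia.
Qed.

Lemma not_near_perfect1 : ~ near_perfect 1.
Proof. by move=> [_ [[|d] []]]. Qed.

Lemma odd_near_perfect_lucas (n : nat) : ~ (odd (lucas n) /\ near_perfect (lucas n)).
Proof.
move=> [ol npl].
have [x ex] := odd_sigma_odd_sqr ol (near_perfect_odd_sigma ol npl).
by apply: not_near_perfect1; move: npl; rewrite (odd_lucas_sqr ol ex).
Qed.

Lemma odd_near_perfect_fib (n : nat) : ~ (odd (fib n) /\ near_perfect (fib n)).
Proof.
move=> [of_ npf]; have os := near_perfect_odd_sigma of_ npf.
suff n12 : n = 1 \/ n = 2.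
  by apply: not_near_perfect1; case: n12 npf => ->.
have [on|en] := boolP (odd n).
  by have [x ex] := odd_sigma_odd_sqr of_ os; left; apply: odd_index_fib_sqr ex.
(* For n = 2 j the factors of F_n = F_j L_j are coprime, so sigma(L_j) is odd as well; L_j is then
   an odd square and j = 1. *)
have [j ej] : exists j, n = 2 * j by exists n./2; lia.
have f0 : 0 < fib n by case: npf.
move: of_ os f0; rewrite ej fib_double oddM muln_gt0 => /andP[ofj olj] + /andP[fj0 lj0].
rewrite sigma_coprimeM ?coprime_fib_lucas // oddM => /andP[_ osl].
have [x ex] := odd_sigma_odd_sqr olj osl.
by right; rewrite (odd_lucas_sqr olj ex).
Qed.

(** * Even Fibonacci numbers with at most three prime factors *)

Lemma leq_size_omega (s : seq nat) (m : nat) :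
  0 < m -> uniq s -> all prime s -> all (dvdn^~ m) s -> size s <= omega m.
Proof.
move=> m0 us /allP ps /allP dv; apply: uniq_leq_size => // p sp.
by rewrite mem_primes ps // m0 dv.
Qed.

Lemma sigma_two_part (m a : nat) :
  0 < a -> 2 ^ a %| m -> ~~ (2 ^ a.+1 %| m) ->
  exists r, [/\ m = 2 ^ a * r, odd r, sigma m = (2 ^ a.+1).-1 * sigma r
              & omega r < omega m].
Proof.
move=> a0 /dvdnP[r ->]; rewrite expnS dvdn_pmul2r ?expn_gt0 // dvdn2 negbK => or_.
have r0 : 0 < r by case: r or_.
exists r; split=> //; first by rewrite mulnC.
  rewrite mulnC sigma_coprimeM ?expn_gt0 ?coprimeXl ?coprime2n // -expnS predn_exp mul1n.
  by rewrite sigma_pfactor.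
by apply: omega_coprime_pfactor; rewrite ?coprime2n.
Qed.

(** Besides 2 and 3, the factors are 7 and 23 if 24 divides n, and 17 and 19 if 36 does. Otherwise n
    = 12 k with k > 1 prime to 6; then F_(2k) = F_k L_k is prime to 6 and each of its two coprime
    factors supplies a prime. *)
Lemma omega_fib_12mul (n : nat) : 12 %| n -> 12 < n -> 3 < omega (fib n).
Proof.
move=> n12 n_gt; have f0 : 0 < fib n by apply: fib_gt0; lia.
have d2 : 2 %| fib n by rewrite (@fib_rank 2 3) //; lia.
have d3 : 3 %| fib n by rewrite (@fib_rank 3 4) //; lia.
have [n24|n24] := boolP (24 %| n).
  apply: (@leq_size_omega [:: 2; 3; 7; 23]) => //; rewrite /= d2 d3.
  by rewrite (@fib_rank 7 8) // (@fib_rank 23 24) //; lia.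
have [n36|n36] := boolP (36 %| n).
  apply: (@leq_size_omega [:: 2; 3; 17; 19]) => //; rewrite /= d2 d3.
  by rewrite (@fib_rank 17 9) // (@fib_rank 19 18) //; lia.
have [k ek] : exists k, n = 12 * k by exists (n %/ 12); lia.
have nd2 : ~~ (2 %| fib (2 * k)) by rewrite (@fib_rank 2 3) //; lia.
have nd3 : ~~ (3 %| fib (2 * k)) by rewrite (@fib_rank 3 4) //; lia.
have ofk : odd (fib k) by rewrite -[odd _]negbK -dvdn2 (@fib_rank 2 3) //; lia.
have fk1 : 1 < fib k by apply: fib_gt1; lia.
have lk1 : 1 < lucas k.
  have -> : k = k.-1.+1 by lia.
  by rewrite lucas_fib (@leq_add 1 1) // fib_gt0 //; lia.
have f2k : fib k * lucas k %| fib n by rewrite -fib_double dvdn_fib // ek dvdn_mul.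
have pf := pdiv_dvd (fib k); have pl := pdiv_dvd (lucas k).
have pfn : pdiv (fib k) %| fib (2 * k) by rewrite fib_double dvdn_mulr.
have pln : pdiv (lucas k) %| fib (2 * k) by rewrite fib_double dvdn_mull.
have ne2 q : q %| fib (2 * k) -> 2 != q by apply: contraTneq => <-.
have ne3 q : q %| fib (2 * k) -> 3 != q by apply: contraTneq => <-.
have npq : pdiv (fib k) != pdiv (lucas k).
  apply/eqP => e; have := coprime_dvdl pf (coprime_dvdr pl (coprime_fib_lucas ofk)).
  by rewrite e /coprime gcdnn gtn_eqF // prime_gt1 // pdiv_prime.
have pkn q : q %| fib (2 * k) -> q %| fib n.
  by move=> qk; rewrite fib_double in qk; apply: dvdn_trans f2k.
apply: (@leq_size_omega [:: 2; 3; pdiv (fib k); pdiv (lucas k)]) => //=; last 2 first.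
- by rewrite !pdiv_prime.
- by rewrite d2 d3 !pkn.
by rewrite !inE !negb_or (ne2 _ pfn) (ne2 _ pln) (ne3 _ pfn) (ne3 _ pln) npq.
Qed.

(** The primes 2, 17, 19 of F_18 always divide. A fourth is 53, of rank 27, if 27 divides n;
    otherwise n = 18 k with k prime to 6, and any prime factor of F_k is new. *)
Lemma omega_fib_18mul (n : nat) : ~~ (4 %| n) -> 18 %| n -> 18 < n -> 3 < omega (fib n).
Proof.
move=> n4 n18 n_gt; have f0 : 0 < fib n by apply: fib_gt0; lia.
have d2 : 2 %| fib n by rewrite (@fib_rank 2 3) //; lia.
have d17 : 17 %| fib n by rewrite (@fib_rank 17 9) //; lia.
have d19 : 19 %| fib n by rewrite (@fib_rank 19 18) //; lia.
have [n27|n27] := boolP (27 %| n).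
  apply: (@leq_size_omega [:: 2; 17; 19; 53]) => //; rewrite /= d2 d17 d19.
  by rewrite (@fib_rank 53 27) //; lia.
have [k ek] : exists k, n = 18 * k by exists (n %/ 18); lia.
have fk1 : 1 < fib k by apply: fib_gt1; lia.
have pf := pdiv_dvd (fib k).
have nd q : ~~ (q %| fib k) -> q != pdiv (fib k).
  by apply: contraNneq => ->.
apply: (@leq_size_omega [:: 2; 17; 19; pdiv (fib k)]) => //=.
  rewrite !inE !negb_or; apply/and4P; split=> //; rewrite ?nd //.
  - by rewrite (@fib_rank 2 3) //; lia.
  - by rewrite (@fib_rank 17 9) //; lia.
  by rewrite (@fib_rank 19 18) //; lia.
- by rewrite pdiv_prime.
rewrite d2 d17 d19 andbT; apply: dvdn_trans pf (dvdn_fib _).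
by rewrite ek dvdn_mull.
Qed.

(** The case n = 12 left out by [omega_fib_12mul]: F_12 = 144 is abundant, but 115 does not divide
    it. *)
Lemma sigma_fib12 : sigma (fib 12) = 2 * fib 12 + 115.
Proof.
have -> : fib 12 = 2 ^ 4 * 3 ^ 2 by [].
by rewrite sigma_coprimeM // !sigma_pfactor // !big_ord_recr !big_ord0.
Qed.

(** The case n = 18 left out by [omega_fib_18mul]: 232 does not divide F_18 = 2584. *)
Lemma sigma_fib18 : sigma (fib 18) = 2 * fib 18 + 232.
Proof.
have -> : fib 18 = 2 ^ 3 * 17 ^ 1 * 19 ^ 1 by vm_compute.
rewrite sigma_coprimeM // sigma_coprimeM // !sigma_pfactor // !big_ord_recr !big_ord0.
by vm_compute.
Qed.

Lemma prime_lt31 (p : nat) : prime p -> p < 31 ->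
  p \in [:: 2; 3; 5; 7; 11; 13; 17; 19; 23; 29].
Proof. by move=> pp p31; move: pp; do 31 case: p p31 => [|p] p31 //. Qed.

(** Here F_n = 8 r with r odd. A factor 9, 5 or 7 of n forces a fourth prime, or n = 18; without
    them the prime factors of r are at least 31. *)
Lemma near_perfect_fib_6mul (n : nat) :
  n %% 12 = 6 -> omega (fib n) <= 3 -> ~ near_perfect (fib n).
Proof.
move=> n12 wn npn; have f0 : 0 < fib n by case: npn.
have n9 : ~~ (9 %| n).
  apply/negP => n9; have [n18|n18] := leqP n 18; last first.
    by have := @omega_fib_18mul n; lia.
  have en : n = 18 by lia.
  move: npn; rewrite en => -[_ [d [dd _]]]; rewrite sigma_fib18 => /addnI ed.
  by move: dd; rewrite -ed (_ : fib 18 = 2584).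
have d2 : 2 %| fib n by rewrite (@fib_rank 2 3) //; lia.
have n5 : ~~ (5 %| n).
  apply/negP => n5.
  have := @leq_size_omega [:: 2; 5; 11; 31] _ f0 isT isT; rewrite /= d2.
  rewrite (@fib_rank 5 5) // (@fib_rank 11 10) // (@fib_rank 31 30) //; lia.
have n7 : ~~ (7 %| n).
  apply/negP => n7.
  have := @leq_size_omega [:: 2; 13; 29; 211] _ f0 isT isT; rewrite /= d2.
  rewrite (@fib_rank 13 7) // (@fib_rank 29 14) // (@fib_rank 211 42) //; lia.
have [||r [er or_ sr wr]] := @sigma_two_part (fib n) 3 isT.
- by rewrite (@fib_rank 8 6) //; lia.
- by rewrite (@fib_rank 16 12) //; lia.
have ge31 p : prime p -> p %| r -> 31 <= p.
  move=> pp pr; rewrite leqNgt; apply/negP => /(prime_lt31 pp).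
  have pf : p %| fib n by rewrite er dvdn_mull.
  have p2 : p != 2 by apply: contraTneq pr => ->; rewrite dvdn2 or_.
  (* The ranks of 3, 5, 7, 11, 13, 17, 19, 23, 29 are 4, 5, 8, 10, 7, 9, 18, 24, 14. Each is a
     multiple of 4, 5, 7 or 9, none of which divides n. *)
  have nr z : period_check fib p (4 * z) (pred1 0) (fun i => z %| i) ->
      0 < z -> ~~ (z %| n) -> False.
    by move=> chk z0; rewrite -(fib_rank n z0 chk) pf.
  rewrite !inE (negbTE p2) /=.
  case/predU1P => [ep|]; first by rewrite ep in nr; apply: (nr 4) => //; lia.
  case/predU1P => [ep|]; first by rewrite ep in nr; apply: (nr 5) => //; lia.
  case/predU1P => [ep|]; first by rewrite ep in nr; apply: (nr 8) => //; lia.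
  case/predU1P => [ep|]; first by rewrite ep in nr; apply: (nr 10) => //; lia.
  case/predU1P => [ep|]; first by rewrite ep in nr; apply: (nr 7) => //; lia.
  case/predU1P => [ep|]; first by rewrite ep in nr; apply: (nr 9) => //; lia.
  case/predU1P => [ep|]; first by rewrite ep in nr; apply: (nr 18) => //; lia.
  case/predU1P => [ep|]; first by rewrite ep in nr; apply: (nr 24) => //; lia.
  by move=> /eqP ep; rewrite ep in nr; apply: (nr 14) => //; lia.
have r0 : 0 < r by case: r or_ {er sr wr ge31}.
(* The bound is exactly sharp enough: 15/8 times 32/30 equals 2, while abundance is strict. *)
have := @sigma_leq_omega 31 2 r r0 isT _ ge31.
have := near_perfect_abundant npn; rewrite sr er; lia.
Qed.

(** Here F_n = 2 r with r odd. If 5 does not divide n, the primes of r are at least 13 and 3/2 times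
    14/12 is below 2. If 5 divides n, the primes of F_n are 2, 5 and 61, and 3/2 times 5/4 times
    61/60 is below 2. *)
Lemma near_perfect_fib_3mul (n : nat) :
  n %% 6 = 3 -> omega (fib n) <= 3 -> ~ near_perfect (fib n).
Proof.
move=> n6 wn npn; have f0 : 0 < fib n by case: npn.
have d2 : 2 %| fib n by rewrite (@fib_rank 2 3) //; lia.
have [||r [er or_ sr wr]] := @sigma_two_part (fib n) 1 isT.
- by [].
- by rewrite (@fib_rank 4 6) //; lia.
have r0 : 0 < r by case: r or_ {er sr wr}.
have pf p : p %| r -> p %| fib n by move=> pr; rewrite er dvdn_mull.
have pn2 p : p %| r -> p != 2.
  by move=> pr; apply: contraTneq pr => ->; rewrite dvdn2 or_.
have := near_perfect_abundant npn; rewrite sr er => ab.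
have [n5|n5] := boolP (5 %| n); last first.
  have ge13 p : prime p -> p %| r -> 13 <= p.
    move=> pp pr; rewrite leqNgt; apply/negP => p13.
    have := prime_lt31 pp (ltn_trans p13 (isT : 13 < 31)).
    have nr z : period_check fib p (4 * z) (pred1 0) (fun i => z %| i) ->
        0 < z -> ~~ (z %| n) -> False.
      by move=> chk z0; rewrite -(fib_rank n z0 chk) pf.
    rewrite !inE (negbTE (pn2 _ pr)) /=.
    case/predU1P => [ep|]; first by rewrite ep in nr; apply: (nr 4) => //; lia.
    case/predU1P => [ep|]; first by rewrite ep in nr; apply: (nr 5) => //; lia.
    case/predU1P => [ep|]; first by rewrite ep in nr; apply: (nr 8) => //; lia.
    case/predU1P => [ep|]; first by rewrite ep in nr; apply: (nr 10) => //; lia.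
    by lia.
  by have := @sigma_leq_omega 13 2 r r0 isT _ ge13; lia.
have d5 : 5 %| fib n by rewrite (@fib_rank 5 5) //; lia.
have d61 : 61 %| fib n by rewrite (@fib_rank 61 15) //; lia.
have [r' cr'] := pfactor_coprime (isT : prime 5) r0; set e := logn 5 r => er'.
have r'0 : 0 < r' by move: r0; rewrite er' muln_gt0 => /andP[].
have e0 : 0 < e.
  by move: d5; rewrite logn_gt0 mem_primes r0 /= er Gauss_dvdr.
have wr' : omega r' < omega r by rewrite [ltnRHS]/(omega r) [in ltnRHS]er' omega_coprime_pfactor.
(* A prime of r' other than 61 would be a fourth prime factor beside 2, 5 and 61. *)
have ge61 p : prime p -> p %| r' -> 61 <= p.
  move=> pp pr'; have pr : p %| r by rewrite er' dvdn_mulr.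
  rewrite leq_eqVlt; apply/orP; left; apply/negPn/negP => p61.
  have p5 : p != 5 by apply: contraTneq pr' => ->; rewrite -prime_coprime.
  have := @leq_size_omega [:: p; 2; 5; 61] _ f0.
  rewrite /= !inE !negb_or (pn2 p) // p5 eq_sym p61 pp d2 d5 d61 pf //= => /(_ isT isT isT); lia.
have wr1 : omega r' <= 1 by lia.
have h61 := @sigma_leq_omega 61 1 r' r'0 isT wr1 ge61.
have := leq_mul h61 (@sigma_pfactor_leq 5 e isT).
rewrite [X in X <= _]mulnACA [X in _ <= X]mulnACA /=.
move: ab; rewrite er' sigma_coprimeM ?expn_gt0 //; last by rewrite coprime_sym coprimeXl.
move: (sigma r' * _) (r' * _) => s t; lia.
Qed.

Lemma near_perfect_fib (n : nat) : ~ (near_perfect (fib n) /\ omega (fib n) <= 3).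
Proof.
move=> [npn wn]; have [n3|n3] := boolP (3 %| n); last first.
  apply: (@odd_near_perfect_fib n); split=> //.
  by rewrite -[odd _]negbK -dvdn2 (@fib_rank 2 3).
have n0 : 0 < n by case: n npn {wn n3} => // -[].
have [n12|n12] := boolP (12 %| n); last first.
  have [n6|n6] : n %% 6 = 3 \/ n %% 12 = 6 by lia.
    exact: near_perfect_fib_3mul npn.
  exact: near_perfect_fib_6mul npn.
have [n_gt|n_le] := ltnP 12 n; first by have := omega_fib_12mul n12 n_gt; lia.
have en : n = 12 by lia.
move: npn; rewrite en => -[_ [d [dd _]]]; rewrite sigma_fib12 => /addnI ed.
by move: dd; rewrite -ed.
Qed.

(** * Even Lucas numbers with two prime factors *)

Lemma lucas_dvdn2 (n : nat) : (2 %| lucas n) = (n %% 3 == 0).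
Proof.
exact: (@period_checkP _ 2 3 n (pred1 0) (fun i => i == 0) lucas_recP).
Qed.

Lemma lucas_dvdn3 (n : nat) : (3 %| lucas n) = (n %% 8 \in [:: 2; 6]).
Proof.
exact: (@period_checkP _ 3 8 n (pred1 0) (fun i => i \in [:: 2; 6]) lucas_recP).
Qed.

Lemma lucas_dvdn7 (n : nat) : (7 %| lucas n) = (n %% 16 \in [:: 4; 12]).
Proof.
exact: (@period_checkP _ 7 16 n (pred1 0) (fun i => i \in [:: 4; 12]) lucas_recP).
Qed.

Lemma lucas_dvdn27 (n : nat) : (27 %| lucas n) = (n %% 72 \in [:: 18; 54]).
Proof.
exact: (@period_checkP _ 27 72 n (pred1 0) (fun i => i \in [:: 18; 54]) lucas_recP).
Qed.

(** These are the indices at which 27 divides L_n, so 27 always brings in 107; the first instance is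
    L_18 = 2 * 27 * 107. *)
Lemma lucas_dvdn107 (n : nat) : (107 %| lucas n) = (n %% 72 \in [:: 18; 54]).
Proof.
exact: (@period_checkP _ 107 72 n (pred1 0) (fun i => i \in [:: 18; 54]) lucas_recP).
Qed.

Lemma lucas_dvdn5 (n : nat) : ~~ (5 %| lucas n).
Proof.
exact: (@period_checkP _ 5 4 n (predC1 0) xpredT lucas_recP).
Qed.

Lemma lucas_mod4_eq2 (n : nat) : (lucas n %% 4 == 2) = (n %% 6 == 0).
Proof.
exact: (@period_checkP _ 4 6 n (pred1 2) (pred1 0) lucas_recP).
Qed.

Lemma lucas_mod8_eq4 (n : nat) : (lucas n %% 8 == 4) = (n %% 12 \in [:: 3; 9]).
Proof.
exact: (@period_checkP _ 8 12 n (pred1 4) (fun i => i \in [:: 3; 9]) lucas_recP).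
Qed.

Lemma lucas_gt18 (n : nat) : 6 < n -> 18 < lucas n.
Proof.
move=> n6; rewrite -(subnK n6); elim: (n - 7) => [|[|i] IH] //.
by rewrite addSn (lucas_recP (i + 7)); apply: leq_trans IH (leq_addr _ _).
Qed.

(** Here L_n = 4 r with r odd. As n is odd, neither 3 nor 7 divides L_n, and 5 never does; so r is a
    power of a prime at least 11, and 7/4 times 11/10 is below 2. *)
Lemma near_perfect_lucas_odd (n : nat) :
  n %% 6 = 3 -> omega (lucas n) = 2 -> ~ near_perfect (lucas n).
Proof.
move=> n6 wn npn; have l0 : 0 < lucas n by case: npn.
have l8 : lucas n %% 8 = 4.
  by apply/eqP; rewrite lucas_mod8_eq4 !inE; lia.
have [||r [er or_ sr wr]] := @sigma_two_part (lucas n) 2 isT; try lia.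
have r0 : 0 < r by case: r or_ {er sr wr}.
have n3 : ~~ (3 %| lucas n) by rewrite lucas_dvdn3 !inE; lia.
have n7 : ~~ (7 %| lucas n) by rewrite lucas_dvdn7 !inE; lia.
have ge11 p : prime p -> p %| r -> 11 <= p.
  move=> pp pr; have : p %| lucas n by rewrite er dvdn_mull.
  rewrite leqNgt => pl; apply/negP => p11.
  have := prime_lt31 pp (ltn_trans p11 (isT : 11 < 31)); rewrite !inE.
  case/predU1P => [e|]; first by rewrite e dvdn2 or_ in pr.
  case/predU1P => [e|]; first by rewrite e (negbTE n3) in pl.
  case/predU1P => [e|]; first by rewrite e (negbTE (lucas_dvdn5 n)) in pl.
  case/predU1P => [e|]; first by rewrite e (negbTE n7) in pl.
  lia.
have wr1 : omega r <= 1 by lia.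
have := @sigma_leq_omega 11 1 r r0 isT wr1 ge11.
have := near_perfect_abundant npn; rewrite sr er; lia.
Qed.

(** Here L_n = 2 r with r a power of an odd prime. A prime at least 5 fails because 3/2 times 5/4 is
    below 2, so r is a power of 3; an exponent above 2 would bring in 107, hence L_n <= 18. *)
Lemma near_perfect_lucas_even (n : nat) :
  6 %| n -> omega (lucas n) = 2 -> near_perfect (lucas n) -> n = 6.
Proof.
move=> n6 wn npn; have l0 : 0 < lucas n by case: npn.
have l4 : lucas n %% 4 = 2.
  by apply/eqP; rewrite lucas_mod4_eq2.
have [||r [er or_ sr wr]] := @sigma_two_part (lucas n) 1 isT; try lia.
have r0 : 0 < r by case: r or_ {er sr wr}.
have wr1 : omega r <= 1 by lia.
have pf p : p %| r -> p %| lucas n by move=> pr; rewrite er dvdn_mull.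
have [r3|r3] := boolP (3 %| r); last first.
  have ge5 p : prime p -> p %| r -> 5 <= p.
    move=> pp pr; rewrite leqNgt; apply/negP => p5; move: pp pr.
    case: p p5 => [|[|[|[|[|]]]]] // _ _; first by rewrite dvdn2 or_.
    by rewrite (negbTE r3).
  have := @sigma_leq_omega 5 1 r r0 isT wr1 ge5.
  by have := near_perfect_abundant npn; rewrite sr er; lia.
have [r' cr'] := pfactor_coprime (isT : prime 3) r0; set e := logn 3 r => er'.
have r'0 : 0 < r' by move: r0; rewrite er' muln_gt0 => /andP[].
have e0 : 0 < e by rewrite logn_gt0 mem_primes r0 r3.
have r'1 : r' = 1.
  apply: omega_eq0 => //; have := omega_coprime_pfactor (isT : prime 3) e0 r'0 cr'.
  by rewrite -er'; lia.
have e2 : e <= 2.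
  rewrite leqNgt; apply/negP => e3.
  have d27 : 27 %| lucas n.
    by apply: pf; rewrite er' dvdn_mull // (@dvdn_exp2l 3 3).
  have d107 : 107 %| lucas n.
    by move: d27; rewrite lucas_dvdn27 lucas_dvdn107.
  have := @leq_size_omega [:: 2; 3; 107] _ l0 isT isT.
  have d2 : 2 %| lucas n by rewrite er dvdn_mulr.
  by rewrite /= d107 d2 (pf 3) // => /(_ isT); lia.
have l18 : lucas n <= 18.
  by rewrite er er' r'1 mul1n (leq_mul2l _ _ 9) (leq_exp2l _ 2).
have [/lucas_gt18|n_le] := ltnP 6 n; first by lia.
have [n0|] : n = 0 \/ n = 6 by lia.
  by move: er; rewrite n0 [lucas 0]/=; lia.
by [].
Qed.

Lemma near_perfect_lucas (n : nat) :
  near_perfect (lucas n) /\ omega (lucas n) = 2 <-> n = 6.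
Proof.
split=> [[npn wn]|->].
  have n3 : 3 %| n.
    have [ol|el] := boolP (odd (lucas n)).
      by case: (@odd_near_perfect_lucas n).
    by move: el; rewrite -dvdn2 lucas_dvdn2.
  have [n6|n6] : n %% 6 = 3 \/ 6 %| n by lia.
    by case: (near_perfect_lucas_odd n6 wn npn).
  exact: near_perfect_lucas_even.
(* The redundant divisor is 3, since sigma(18) = 39 = 36 + 3. *)
split=> //; split=> //; exists 3; split=> //.
have -> : lucas 6 = 2 ^ 1 * 3 ^ 2 by [].
by rewrite sigma_coprimeM // !sigma_pfactor // !big_ord_recr !big_ord0.
Qed.

Theorem theorem1p1 :
  [/\ forall n : nat,
        ~ (odd (fib n) /\ near_perfect (fib n)) /\
        ~ (odd (lucas n) /\ near_perfect (lucas n)),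
      forall n : nat, ~ (near_perfect (fib n) /\ omega (fib n) <= 3)
    & lucas 6 = 18 /\
      forall n : nat,
        (near_perfect (lucas n) /\ omega (lucas n) = 2) <-> n = 6].
Proof.
split=> [n||]; last 1 first.
- by split=> //; exact: near_perfect_lucas.
- by split; [exact: odd_near_perfect_fib | exact: odd_near_perfect_lucas].
exact: near_perfect_fib.
Qed.
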